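(* Let $\alpha$ be a monotone unbalanced connective whose characteristic polynomial $A_\alpha$ has a fixed-point $t\in(0,1)$, and let the support of $\mu$ consist only of the $n$ projections. Then the limiting distribution of the growth process $(\mu,\alpha)$ is concentrated on the threshold function $T_{\lceil tn\rceil}(x_1,\dots,x_n)$.
   Context: A connective is a $k$-adic Boolean function $\alpha:\{0,1\}^k\to\{0,1\}$; it is balanced if it takes the value 1 on exactly half of its inputs, and unbalanced otherwise. Its characteristic polynomial is $A_\alpha(p)=\Pr[\alpha(X_1,\dots,X_k)=1]=\sum_{j=0}^k\beta_j\binom kj p^j(1-p)^{k-j}$, where the $X_j$ are independent binary variables each equal to 1 with probability $p$, and $\beta_j$ is the fraction of assignments of weight $j$ for which $\alpha$ is true. The initial distribution $\mu$ is uniform on its support, here the projections $x_1,\dots,x_n$. The growth process $(\mu,\alpha)$ gives distributions $\pi_i$ on $n$-adic Boolean functions: $\pi_0=\mu$, and for $i\ge1$, $\pi_i(f)$ is the probability that $\alpha(g_1,\dots,g_k)=f$ where $g_1,\dots,g_k$ are independent random functions distributed according to $\pi_{i-1}$. The limiting distribution is $\pi=\lim_{i\to\infty}\pi_i$ (pointwise); it is concentrated on $f$ if $\pi(f)=1$. The threshold function $T_m(x_1,\dots,x_n)$ is 1 if and only if at least $m$ of its $n$ arguments are 1. *)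

(* Defs.v *)
From HB Require Import structures.
From mathcomp Require Import all_boot all_order all_algebra.
From mathcomp Require Import all_classical all_reals all_analysis.

Set Implicit Arguments.
Unset Strict Implicit.
Unset Printing Implicit Defensive.

Import Order.TTheory GRing.Theory Num.Theory.
Import numFieldNormedType.Exports.

Local Open Scope ring_scope.

Definition cube (n : nat) := {ffun 'I_n -> bool}.
Definition boolfun (n : nat) := {ffun cube n -> bool}.

Definition weight (n : nat) (x : cube n) : nat := #|[set i | x i]%SET|.

Definition proj_fun (n : nat) (i : 'I_n) : boolfun n := 
  [ffun x : cube n => x i].

Definition threshold_fun (n m : nat) : boolfun n :=
  [ffun x : cube n => (m <= weight x)%N].

Definition monotone_connective (k : nat) (alpha : boolfun k) : Prop :=
  forall x y : cube k, (forall j, x j -> y j) -> alpha x -> alpha y.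

Definition balanced_connective (k : nat) (alpha : boolfun k) : bool :=
  (2 * #|[set x | alpha x]%SET| == #|{: cube k}|)%N.

Definition level_fraction (R : realType) (k : nat) (alpha : boolfun k)
    (j : nat) : R :=
  #|[set x : cube k | (weight x == j) && alpha x]%SET|%:R /
  #|[set x : cube k | weight x == j]%SET|%:R.

Definition characteristic_poly (R : realType) (k : nat) (alpha : boolfun k)
    : {poly R} :=
  \sum_(j < k.+1) (level_fraction R alpha j * 'C(k, j)%:R) *:
    ('X ^+ j * (1 - 'X) ^+ (k - j)).

Lemma card_level (k j : nat) :
  #|[set x : cube k | weight x == j]%SET| = 'C(k, j).
Proof.
pose F (x : cube k) : {set 'I_k} := [set i | x i]%SET.
have injF : injective F.
  move=> x y /setP eqF; apply/ffunP => i.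
  by have := eqF i; rewrite !inE.
rewrite -[in RHS](card_ord k) -card_draws -(card_imset _ injF).
apply: eq_card => A; rewrite inE; apply/imsetP/idP => [[x]|cA].
  by rewrite inE => + ->.
have FA : F [ffun i => i \in A] = A by apply/setP => i; rewrite inE ffunE.
by exists [ffun i => i \in A]; rewrite ?inE -/(F _) ?FA // /weight -/(F _) FA.
Qed.

(* The value of the characteristic polynomial at [p] is the probability that
   [alpha] is true on independent inputs that are 1 with probability [p]. *)
Lemma characteristic_polyE (R : realType) (k : nat) (alpha : boolfun k)
    (p : R) :
  (characteristic_poly R alpha).[p] =
  \sum_(x : cube k | alpha x) \prod_(j < k) (if x j then p else 1 - p).
Proof.
have wlt (x : cube k) : (weight x < k.+1)%N.
  by rewrite ltnS -[leqRHS](card_ord k) max_card.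
rewrite (partition_big (fun x : cube k => Ordinal (wlt x)) xpredT) //=.
rewrite horner_sum; apply: eq_bigr => j _.
rewrite (eq_bigr (fun=> p ^+ j * (1 - p) ^+ (k - j))); last first.
  move=> x /andP[_ /eqP <-] /=; rewrite (bigID (fun i => x i)) /=.
  congr (_ * _).
    rewrite (eq_bigr (fun=> p)) => [|i ->//].
    by rewrite prodr_const /weight cardsE.
  rewrite (eq_bigr (fun=> 1 - p)) => [|i /negbTE ->//].
  rewrite prodr_const; congr (_ ^+ _).
  have -> : (k - weight x)%N = #|~: [set i | x i]%SET|.
    by rewrite cardsCs finset.setCK card_ord.
  by apply: eq_card => i; rewrite !inE.
rewrite sumr_const hornerZ hornerM !horner_exp hornerD hornerN hornerX hornerC.
rewrite -[RHS]mulr_natl; congr (_ * _).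
rewrite /level_fraction card_level divfK; last first.
  by rewrite pnatr_eq0 -lt0n bin_gt0 -ltnS.
congr (_%:R); apply: eq_card => x.
by rewrite inE unfold_in /= -val_eqE /= andbC.
Qed.

Definition is_distr (R : realType) (T : finType) (mu : T -> R) : Prop :=
  (forall f, 0 <= mu f) /\ \sum_f mu f = 1.

Definition distr_support (R : realType) (T : finType) (mu : T -> R)
    : {set T} := [set f | mu f != 0]%SET.

Definition uniform_on_support (R : realType) (T : finType) (mu : T -> R)
    : Prop :=
  forall f g, f \in distr_support mu -> g \in distr_support mu -> mu f = mu g.

Definition projections (n : nat) : {set boolfun n} :=
  [set proj_fun i | i : 'I_n]%SET.

Definition bcomp (k n : nat) (alpha : boolfun k)
    (g : {ffun 'I_k -> boolfun n}) : boolfun n :=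
  [ffun x : cube n => alpha [ffun j => g j x]].

Definition growth_step (R : realType) (k n : nat) (alpha : boolfun k)
    (pi : boolfun n -> R) : boolfun n -> R :=
  fun f => \sum_(g : {ffun 'I_k -> boolfun n} | bcomp alpha g == f)
             \prod_(j < k) pi (g j).

Definition growth_distr (R : realType) (k n : nat) (mu : boolfun n -> R)
    (alpha : boolfun k) (i : nat) : boolfun n -> R :=
  iter i (growth_step alpha) mu.

(* [limn] returns an arbitrary value on divergent sequences, so results about
   [limit_distr] are meaningful only together with [has_limit_distr]. *)
Definition has_limit_distr (R : realType) (k n : nat) (mu : boolfun n -> R)
    (alpha : boolfun k) : Prop :=
  forall f, cvgn (fun i => growth_distr mu alpha i f).

Definition limit_distr (R : realType) (k n : nat) (mu : boolfun n -> R)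
    (alpha : boolfun k) : boolfun n -> R :=
  fun f => limn (fun i => growth_distr mu alpha i f).

Definition concentrated_on (R : realType) (T : finType) (pi : T -> R) (f : T)
    : Prop := pi f = 1.

(* Main.v *)
Require Import Defs.
From mathcomp Require Import all_boot all_order all_algebra reals.
From mathcomp Require Import all_classical all_reals all_analysis.
From mathcomp Require Import ring lra.

(* On an input of weight w the growth process iterates p |-> A(p) from w/n, so
   the claim is that the orbit of w/n tends to 0 or 1 according to whether
   w/n < t or w/n > t, and that w/n = t never happens.
   The Moore-Shannon inequality keeps A above the identity to the right of a
   fixed point and below it to the left; between two fixed points in (0,1) A
   would thus be the identity. An integrality argument shows that no rational
   in (0,1) is fixed by A. This excludes w/n = t and, by density of the
   rationals, also a second fixed point. *)

Set Implicit Arguments.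
Unset Strict Implicit.
Unset Printing Implicit Defensive.

Import Order.TTheory GRing.Theory Num.Theory.
Import numFieldNormedType.Exports.

Local Open Scope ring_scope.

(** * Weighted sums over the Boolean cube *)

Section CubeSum.

Variable R : comNzRingType.
Implicit Types (u v : R) (k : nat).

(** The weights [u] and [v] need not add up to 1 and live in any commutative ring, so that the same
    sum serves probabilities ([p], [1 - p]) and, once denominators are cleared, integers. *)
Definition cube_wt u v k (x : cube k) : R := \prod_(j < k) (if x j then u else v).

Definition cube_sum u v k (f : pred (cube k)) : R :=
  \sum_(x | f x) cube_wt u v x.

Definition cube_cons k (b : bool) (x : cube k) : cube k.+1 :=
  [ffun i => if unlift ord0 i is Some j then x j else b].

Lemma cube_wt_cons u v k b (x : cube k) :
  cube_wt u v (cube_cons b x) = (if b then u else v) * cube_wt u v x.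
Proof.
rewrite /cube_wt big_ord_recl ffunE unlift_none; congr (_ * _).
by apply: eq_bigr => j _; rewrite ffunE liftK.
Qed.

(** Shannon expansion along the first input; it drives the induction on the arity in [bern_tilt]. *)
Lemma cube_sum_cons u v k (f : pred (cube k.+1)) :
  cube_sum u v f = u * cube_sum u v (fun x => f (cube_cons true x)) +
                   v * cube_sum u v (fun x => f (cube_cons false x)).
Proof.
pose c (bx : bool * cube k) := cube_cons bx.1 bx.2.
pose d (y : cube k.+1) := (y ord0, [ffun j => y (lift ord0 j)] : cube k).
rewrite /cube_sum (reindex c) /=; last first.
  exists d => [[b x] _|y _].
    rewrite /c /d /= ffunE unlift_none; congr (_, _).
    by apply/ffunP => j; rewrite !ffunE liftK.
  apply/ffunP => i; rewrite ffunE; case: unliftP => [j ->|->] //=.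
  by rewrite ffunE.
rewrite -(pair_big_dep xpredT (fun b x => f (cube_cons b x))
  (fun b x => cube_wt u v (cube_cons b x))) /= big_bool.
by congr (_ + _); rewrite big_distrr; apply: eq_bigr => x _ /=; rewrite cube_wt_cons.
Qed.

Lemma sum_prod_cube k (F : 'I_k -> bool -> R) :
  \sum_(x : cube k) \prod_j F j (x j) = \prod_j (F j true + F j false).
Proof.
under [RHS]eq_bigr => j _ do rewrite -big_bool.
by rewrite bigA_distr_bigA.
Qed.

Lemma cube_sum_true u v k : cube_sum u v (fun _ : cube k => true) = (u + v) ^+ k.
Proof.
rewrite /cube_sum /cube_wt (sum_prod_cube (fun _ b => if b then u else v)).
by rewrite prodr_const card_ord.
Qed.

Lemma cube_sum_proj u v k (j : 'I_k) :
  cube_sum u v (fun x => x j) = u * (u + v) ^+ k.-1.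
Proof.
(* Setting the weight of a false [j]-th bit to 0 encodes the condition [x j], so the sum factors
   over the coordinates. *)
pose F i b := if b then u else if i == j then 0 else v.
transitivity (\sum_(x : cube k) \prod_i F i (x i)).
  rewrite [LHS]big_mkcond; apply: eq_bigr => x _ /=.
  case: ifPn => xj.
    apply: eq_bigr => i _; rewrite /F; case: ifPn => // xi.
    by case: eqP => // ij; rewrite ij xj in xi.
  by rewrite (bigD1 j) //= /F (negbTE xj) eqxx mul0r.
rewrite sum_prod_cube (bigD1 j) //= /F eqxx addr0; congr (_ * _).
rewrite (eq_bigr (fun=> u + v)) => [|i /negbTE -> //].
by rewrite prodr_const cardC1 card_ord.
Qed.

Lemma cube_sumC u v k (f : pred (cube k)) :
  cube_sum u v f + cube_sum u v (predC f) = (u + v) ^+ k.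
Proof. by rewrite -cube_sum_true /cube_sum [RHS](bigID f). Qed.

Lemma cube_wtE u v k (x : cube k) :
  cube_wt u v x = u ^+ weight x * v ^+ (k - weight x).
Proof.
rewrite /cube_wt (bigID (fun j => x j)) /=; congr (_ * _).
  by rewrite (eq_bigr (fun=> u)) => [|j -> //]; rewrite ?prodr_const /weight cardsE.
rewrite (eq_bigr (fun=> v)) => [|j /negbTE -> //].
rewrite prodr_const; congr (_ ^+ _).
have -> : (k - weight x)%N = #|~: [set i | x i]%SET|.
  by rewrite cardsCs finset.setCK card_ord.
by apply: eq_card => i; rewrite !inE.
Qed.

End CubeSum.

(** * Bernoulli probabilities and the Moore-Shannon inequality *)

Section Bernoulli.

Variable R : realFieldType.
Implicit Types (p : R) (k : nat).

Definition bern p k (f : pred (cube k)) : R := cube_sum p (1 - p) f.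

Lemma cube_wt_ge0 p k (x : cube k) : 0 <= p <= 1 -> 0 <= cube_wt p (1 - p) x.
Proof.
by move=> /andP[p0 p1]; apply: prodr_ge0 => j _; case: ifP => // _; rewrite subr_ge0.
Qed.

Lemma cube_wt_gt0 p k (x : cube k) : 0 < p < 1 -> 0 < cube_wt p (1 - p) x.
Proof.
by move=> /andP[p0 p1]; apply: prodr_gt0 => j _; case: ifP => // _; rewrite subr_gt0.
Qed.

Lemma bernC p k (f : pred (cube k)) : bern p f + bern p (predC f) = 1.
Proof. by rewrite cube_sumC [p + _]addrC subrK expr1n. Qed.

Lemma bern_proj p k (j : 'I_k) : bern p (fun x => x j) = p.
Proof. by rewrite /bern cube_sum_proj [p + _]addrC subrK expr1n mulr1. Qed.

Lemma bern_le p k (f g : pred (cube k)) :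
  0 <= p <= 1 -> (forall x, f x -> g x) -> bern p f <= bern p g.
Proof.
move=> p01 fg; rewrite /bern /cube_sum [leLHS]big_mkcond [leRHS]big_mkcond /=.
apply: ler_sum => x _; case: ifP => [/fg -> //|_].
by case: ifP => // _; apply: cube_wt_ge0.
Qed.

Lemma bern_ge0 p k (f : pred (cube k)) : 0 <= p <= 1 -> 0 <= bern p f.
Proof. by move=> p01; apply: sumr_ge0 => x _; apply: cube_wt_ge0. Qed.

Lemma bern_le1 p k (f : pred (cube k)) : 0 <= p <= 1 -> bern p f <= 1.
Proof. by move=> p01; rewrite -(bernC p f) lerDl bern_ge0. Qed.

(** Inside (0,1) every point of the cube has positive mass, so a point in [g] but not in [f] would
    make the probabilities differ. *)
Lemma bern_inj p k (f g : pred (cube k)) : 0 < p < 1 ->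
  (forall x, f x -> g x) -> bern p f = bern p g -> f =1 g.
Proof.
move=> p01 fg fgE x; apply/idP/idP => [/fg //|gx].
apply: contraT => nfx; have p01w : 0 <= p <= 1 by case/andP: p01 => /ltW-> /ltW->.
have : bern p f < bern p g.
  rewrite /bern /cube_sum [ltRHS](bigID f) /= -[ltLHS]addr0 ler_ltD //.
    by apply: (@bern_le p k _ [pred x | g x && f x] p01w) => y fy /=; rewrite fg ?fy.
  rewrite (bigD1 x) ?gx //= ltr_wpDr ?cube_wt_gt0 //.
  by apply: sumr_ge0 => y _; apply: cube_wt_ge0.
by rewrite fgE ltxx.
Qed.

(** The probability whose odds are 1 + s times the odds x/(1-x). *)
Definition tilt (s x : R) : R := (1 + s) * x / (1 + s * x).

Lemma tilt_ge0 (s x : R) : 0 <= s -> 0 <= x -> 0 <= tilt s x.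
Proof.
by move=> s0 x0; rewrite divr_ge0 ?mulr_ge0 ?addr_ge0 ?mulr_ge0.
Qed.

Lemma tilt_le1 (s x : R) : 0 <= s -> 0 <= x -> x <= 1 -> tilt s x <= 1.
Proof.
by move=> s0 x0 x1; rewrite ler_pdivrMr ?ltr_pwDl ?mulr_ge0 //; lra.
Qed.

Lemma tilt_lt (s x y : R) : 0 <= s -> 0 <= x -> x < y -> tilt s x < tilt s y.
Proof.
move=> s0 x0 xy; have y0 : 0 <= y by lra.
rewrite ltr_pdivrMr ?ltr_pwDl ?mulr_ge0 // mulrAC.
by rewrite ltr_pdivlMr ?ltr_pwDl ?mulr_ge0 //; nra.
Qed.

Lemma tilt_le (s x y : R) : 0 <= s -> 0 <= x -> x <= y -> tilt s x <= tilt s y.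
Proof. by move=> s0 x0; rewrite le_eqVlt => /predU1P[-> //|/(tilt_lt s0 x0)/ltW]. Qed.

Lemma tilt_surj (p r : R) : 0 < p -> p <= r -> r < 1 ->
  exists2 s, 0 <= s & tilt s p = r.
Proof.
move=> p0 pr r1; have q0 : 0 < 1 - r by lra.
(* Solves 1 + s = r(1-p) / (p(1-r)), the ratio of the odds of [r] and [p]. *)
exists ((r - p) / (p * (1 - r))).
  by rewrite divr_ge0 ?mulr_ge0 ?subr_ge0 // ltW.
by rewrite /tilt; field; rewrite !gt_eqF //; lra.
Qed.

(** The induction step of [bern_tilt]: [a] and [b] stand for the probabilities of the two cofactors,
    with first input 1 and 0, and [b <= a] reflects monotonicity. *)
Lemma tilt_mix (s p a b : R) : 0 <= s -> 0 <= p <= 1 -> 0 <= b <= a -> a <= 1 ->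
  tilt s (p * a + (1 - p) * b) <=
  tilt s p * tilt s a + (1 - tilt s p) * tilt s b.
Proof.
move=> s0 /andP[p0 p1] /andP[b0 ba] a1.
have a0 : 0 <= a by lra.
set m := p * a + (1 - p) * b.
have m0 : 0 <= m by rewrite addr_ge0 ?mulr_ge0 // subr_ge0.
have den x : 0 <= x -> 0 < 1 + s * x by move=> x0; rewrite ltr_pwDl ?mulr_ge0.
rewrite -subr_ge0.
(* The difference of the two sides is an explicit fraction, all of whose factors are nonnegative. *)
suff -> : tilt s p * tilt s a + (1 - tilt s p) * tilt s b - tilt s m =
    (1 + s) * s * (p * (1 - p) * (a - b) * (1 - (a - b) + s * b)) /
    ((1 + s * p) * (1 + s * a) * (1 + s * b) * (1 + s * m)).
  have sb0 : 0 <= s * b by rewrite mulr_ge0.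
  rewrite divr_ge0 ?mulr_ge0 ?(ltW (den _ _)) ?subr_ge0 //; lra.
rewrite /tilt /m; field.
by rewrite !gt_eqF ?den.
Qed.

(* The Moore-Shannon inequality p(1-p)A' >= A(1-A) in integrated form: raising
   the odds of the inputs by the factor 1 + s raises the odds of the output by
   at least 1 + s. *)
Lemma bern_tilt (s p : R) k (f : pred (cube k)) : 0 <= s -> 0 <= p <= 1 ->
  (forall x y : cube k, (forall j, x j -> y j) -> f x -> f y) ->
  tilt s (bern p f) <= bern (tilt s p) f.
Proof.
move=> s0 p01; have /andP[p0 p1] := p01.
have t01 : 0 <= tilt s p <= 1 by rewrite tilt_ge0 ?tilt_le1.
elim: k f => [|k IHk] f fmono.
  (* Without inputs [f] is constant, and [tilt s] fixes both 0 and 1. *)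
  have bern0 q : bern q f = (f [ffun=> true])%:R.
    rewrite /bern /cube_sum /cube_wt; under eq_bigr do rewrite big_ord0.
    rewrite big_mkcond (big_pred1 [ffun=> true]) => [|x]; first by case: (f _).
    by apply/esym/eqP/ffunP => - [].
  rewrite !bern0 /tilt; case: (f _); last by rewrite mulr0 mul0r.
  by rewrite !mulr1 divff // gt_eqF // ltr_pwDl.
rewrite /bern !cube_sum_cons -!/(bern _ _).
have mono b (x y : cube k) : (forall j, x j -> y j) ->
    f (cube_cons b x) -> f (cube_cons b y).
  by move=> xy; apply: fmono => i; rewrite !ffunE; case: unlift.
have b10 : bern p (fun x => f (cube_cons false x)) <=
           bern p (fun x => f (cube_cons true x)).
  by apply: bern_le => // x; apply: fmono => i; rewrite !ffunE; case: unlift.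
apply: (le_trans (tilt_mix _ _ _ _)); rewrite ?p01 ?b10 ?bern_ge0 ?bern_le1 //.
case/andP: t01 => t0 t1.
by rewrite lerD // ler_wpM2l ?subr_ge0 // IHk //; apply: mono.
Qed.

End Bernoulli.

(** Carries fixed-point equations between the integers, the rationals and a real field. *)
Lemma cube_sum_rmorph (R S : comNzRingType) (phi : {rmorphism R -> S}) (u v : R)
    k (f : pred (cube k)) :
  phi (cube_sum u v f) = cube_sum (phi u) (phi v) f.
Proof.
rewrite rmorph_sum; apply: eq_bigr => x _; rewrite rmorph_prod.
by apply: eq_bigr => j _; case: ifP.
Qed.

Lemma cube_sum_scale (R : comNzRingType) (c u v : R) k (f : pred (cube k)) :
  cube_sum (c * u) (c * v) f = c ^+ k * cube_sum u v f.
Proof.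
rewrite big_distrr; apply: eq_bigr => x _ /=.
rewrite /cube_wt -[in c ^+ k](card_ord k) -prodr_const -big_split /=.
by apply: eq_bigr => j _; case: ifP.
Qed.

(** At 1/2 every assignment has mass 2^-k, so the probability is the proportion of true
    assignments. *)
Lemma bern_half (R : realFieldType) k (alpha : boolfun k) :
  bern (2^-1 : R) alpha = 2^-1 -> balanced_connective alpha.
Proof.
have -> : bern (2^-1 : R) alpha = #|[set x | alpha x]%SET|%:R / 2 ^+ k.
  rewrite /bern (_ : 1 - 2^-1 = 2^-1); last by field.
  rewrite /cube_sum (eq_bigr (fun=> 2^-1 ^+ k)) => [|x _].
    by rewrite sumr_const exprVn -[LHS]mulr_natl cardsE.
  by rewrite /cube_wt (eq_bigr (fun=> 2^-1)) ?prodr_const ?card_ord // => j _; case: ifP.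
move=> half; rewrite /balanced_connective card_ffun card_bool card_ord.
rewrite -(eqr_nat R) natrM natrX.
have two_neq0 : (2 ^+ k : R) != 0 by rewrite expf_neq0 // pnatr_eq0.
apply/eqP; move/(congr1 (fun z => 2 * z * 2 ^+ k)): half.
by rewrite mulrA mulfVK // divff ?pnatr_eq0 // mul1r.
Qed.

(** * Fixed points in (0,1) of a monotone unbalanced connective *)

Section FixedPoint.

Variables (k : nat) (alpha : boolfun k).
Hypothesis alpha_mono : monotone_connective alpha.
Hypothesis alpha_unbal : ~~ balanced_connective alpha.

(** A projection is true with probability 1/2 at p = 1/2, hence is balanced. *)
Lemma not_dictator (j : 'I_k) : ~ (alpha =1 fun x => x j).
Proof.
move=> aj; move/negP: alpha_unbal; apply; apply: (@bern_half rat).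
by rewrite -[RHS](bern_proj _ j); apply: eq_bigl.
Qed.

Section OneFixedPoint.

Variables (R : realFieldType) (p : R).
Hypotheses (p01 : 0 < p < 1) (pfix : bern p alpha = p).

Let p01w : 0 <= p <= 1. Proof. by case/andP: p01 => /ltW-> /ltW->. Qed.

(** If [alpha] were true where only bit [j] is set, monotonicity would put the [j]-th projection
    below [alpha]; both have probability [p], so they would coincide. If it were true at the zero
    input, it would be constant and give A(p) = 1. *)
Lemma fixed_weight_ge2 x : alpha x -> (2 <= weight x)%N.
Proof.
move=> ax; rewrite ltnNge leq_eqVlt ltnS leqn0; apply/negP => /orP[/cards1P[j xj]|].
  apply: (@not_dictator j); apply: fsym.
  apply: (bern_inj p01) => [y yj|]; last by rewrite bern_proj pfix.
  apply: alpha_mono ax => i xi; suff -> : i = j by [].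
  by apply/set1P; rewrite -xj inE.
rewrite cards_eq0 => /eqP x0.
have : bern p (xpredT : pred (cube k)) <= bern p alpha.
  apply: bern_le => // y _; apply: alpha_mono ax => i xi.
  by have := finset.in_set0 i; rewrite -x0 inE xi.
have := bernC p (xpredT : pred (cube k)).
rewrite pfix [X in _ + X]big_pred0 ?addr0 => [->|//].
by case/andP: p01 => _; rewrite leNgt => ->.
Qed.

(** Dual of [fixed_weight_ge2], with zeros in place of ones. *)
Lemma fixed_coweight_ge2 x : ~~ alpha x -> (2 <= k - weight x)%N.
Proof.
move=> nax; have -> : (k - weight x)%N = #|~: [set i | x i]%SET|.
  by rewrite cardsCs finset.setCK card_ord.
rewrite ltnNge leq_eqVlt ltnS leqn0; apply/negP => /orP[/cards1P[j xj]|].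
  apply: (@not_dictator j).
  apply: (bern_inj p01) => [y ay|]; last by rewrite bern_proj pfix.
  apply: contraNT nax => nyj; apply: alpha_mono ay => i yi.
  apply: contraT => nxi; suff ij : i = j by rewrite -ij yi in nyj.
  by apply/set1P; rewrite -xj !inE.
rewrite cards_eq0 => /eqP x0.
have : bern p alpha = 0.
  apply: big_pred0 => y; apply: contraNF nax => ay; apply: alpha_mono ay => i _.
  by have := finset.in_set0 i; rewrite -x0 !inE => /negbFE.
by case/andP: p01; rewrite -{1}pfix => p0 _ p00; rewrite p00 ltxx in p0.
Qed.

Lemma bern0_fixed : bern 0 alpha = 0 :> R.
Proof.
apply: big1 => x /fixed_weight_ge2; rewrite cube_wtE expr0n.
by case: (weight x) => // w _; rewrite mul0r.
Qed.

Lemma bern1_fixed : bern 1 alpha = 1 :> R.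
Proof.
rewrite -[RHS](bernC 1 alpha) [X in _ + X]big1 ?addr0 // => x /fixed_coweight_ge2.
by rewrite cube_wtE subrr expr0n; case: (_ - _)%N => // w _; rewrite mulr0.
Qed.

End OneFixedPoint.

(* For q = u/d in lowest terms, A(q) = q reads
   [sum of u^|x| (d-u)^(k-|x|) over alpha x = u d^(k-1)]. Every term is divisible
   by u^2, so u divides d^(k-1) and u = 1; by duality d - u = 1, whence q = 1/2,
   which would make alpha balanced. *)
Lemma rat_not_fixed (q : rat) : 0 < q < 1 -> bern q alpha <> q.
Proof.
move=> q01 qfix; have [q0 q1] := andP q01.
pose u := numq q; pose d := denq q; pose v := d - u.
have d_neq0 : (d%:~R : rat) != 0 by rewrite intr_eq0 denq_neq0.
have qE : q = u%:~R / d%:~R by rewrite divq_num_den.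
have u_gt0 : 0 < u by rewrite numq_gt0.
have v_gt0 : 0 < v.
  rewrite subr_gt0 -(ltr_int rat).
  by move: q1; rewrite [q in q < 1]qE ltr_pdivrMr ?mul1r // ltr0z denq_gt0.
(* With no inputs A would be constantly 0 or 1, whereas q lies strictly between. *)
have [k' kE] : exists k', k = k'.+1.
  move: (alpha) qfix; case: (k) => [a|k']; last by exists k'.
  rewrite /bern /cube_sum /cube_wt; under eq_bigr do rewrite big_ord0.
  rewrite sumr_const; set c := #|_|.
  have : (c <= 1)%N by rewrite (leq_trans (max_card _)) // card_ffun card_ord expn0.
  by case: c => [|[|//]] _ qE'; move: q0 q1; rewrite -qE' ltxx.
(* The equation A(q) = q multiplied by d^k. *)
have sumE : cube_sum u v alpha = u * d ^+ k'.
  apply: (@intr_inj rat); rewrite cube_sum_rmorph /=.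
  have -> : u%:~R = d%:~R * q :> rat by rewrite qE mulrCA divff ?mulr1.
  have -> : v%:~R = d%:~R * (1 - q) :> rat.
    by rewrite mulrBr mulr1 qE mulrCA divff ?mulr1 // rmorphB.
  rewrite cube_sum_scale [cube_sum _ _ _]qfix rmorphM rmorphXn /=.
  by rewrite [in k in _ ^+ k]kE exprS qE; field.
(* The same for the false inputs, since the two sums add up to (u + v)^k = d^k. *)
have sumCE : cube_sum u v (predC alpha) = v * d ^+ k'.
  have := cube_sumC u v alpha; rewrite sumE [u + v]addrC subrK.
  by move/(canRL (addKr _)) => ->; rewrite [in _ ^+ k]kE exprS /v; ring.
have dvd_one (w : int) : 0 < w -> coprimez w d -> (w ^+ 2 %| w * d ^+ k')%Z -> w = 1.
  move=> w0 cwd; rewrite expr2 dvdz_mul2l ?gt_eqF // => wd.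
  have /eqP : gcdz w (d ^+ k') == 1 by rewrite -/(coprimez _ _) coprimezXr.
  by move/gcdz_idPl: wd => ->; rewrite gtz0_abs.
have u1 : u = 1.
  apply: dvd_one => //; first by rewrite coprimezE coprime_num_den.
  rewrite -sumE; apply: rpred_sum => x /(fixed_weight_ge2 q01 qfix) x2.
  by rewrite cube_wtE dvdz_mulr // dvdz_exp2l.
have v1 : v = 1.
  apply: dvd_one => //.
    have /coprimezP[[a b] /= ab1] : coprimez u d by rewrite coprimezE coprime_num_den.
    (* From a u + b d = 1 and v = d - u follows -a v + (a + b) d = 1. *)
    by apply/coprimezP; exists (- a, a + b); rewrite -ab1 /v /=; ring.
  rewrite -sumCE; apply: rpred_sum => x /(fixed_coweight_ge2 q01 qfix) x2.
  by rewrite cube_wtE dvdz_mull // dvdz_exp2l.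
have d2 : d = 2 by rewrite -[d](subrK u) -/v v1 u1.
have q2 : q = 2^-1 by rewrite qE u1 d2 div1r.
by move/negP: alpha_unbal; apply; apply: (@bern_half rat); rewrite -{1}q2 qfix.
Qed.

Lemma fixed_irrational (R : realFieldType) (q : rat) :
  0 < (ratr q : R) < 1 -> bern (ratr q : R) alpha <> ratr q.
Proof.
move=> q01 qfix; apply: (@rat_not_fixed q).
  by case/andP: q01; rewrite ltr0q -(ltr_rat R q 1) rmorph1 => -> ->.
apply: (fmorph_inj (@ratr R)); rewrite -[RHS]qfix cube_sum_rmorph.
by rewrite rmorphB rmorph1.
Qed.

(** Writing r as a tilt of p gives A(r) >= tilt(A(p)) >= tilt(p) = r, by [bern_tilt] and
    monotonicity of [tilt]. *)
Lemma bern_le_above (R : realFieldType) (p r : R) :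
  0 < p -> p <= r -> r < 1 -> p <= bern p alpha -> r <= bern r alpha.
Proof.
move=> p0 pr r1 pA; have [s s0 <-] := tilt_surj p0 pr r1.
have p01 : 0 <= p <= 1 by rewrite ltW //= (le_trans pr) ?ltW.
exact: le_trans (tilt_le s0 (ltW p0) pA) (bern_tilt s0 p01 alpha_mono).
Qed.

Lemma bern_lt_above (R : realFieldType) (p r : R) :
  0 < p -> p <= r -> r < 1 -> p < bern p alpha -> r < bern r alpha.
Proof.
move=> p0 pr r1 pA; have [s s0 <-] := tilt_surj p0 pr r1.
have p01 : 0 <= p <= 1 by rewrite ltW //= (le_trans pr) ?ltW.
exact: lt_le_trans (tilt_lt s0 (ltW p0) pA) (bern_tilt s0 p01 alpha_mono).
Qed.

(** Take a rational q strictly between. The fixed point p forces A(q) >= q, and A(q) > q would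
    propagate to A(r) > r; so q is fixed, against [fixed_irrational]. *)
Lemma bern_fixed_unique (R : archiRealFieldType) (p r : R) :
  0 < p < 1 -> 0 < r < 1 -> bern p alpha = p -> bern r alpha = r -> p = r.
Proof.
wlog pr : p r / p < r => [th p01 r01 pfix rfix|].
  by case: (ltgtP p r) => // [pr|rp]; [exact: th|apply/esym/th].
move=> /andP[p0 _] /andP[_ r1] pfix rfix; exfalso.
have [q] := rat_in_itvoo pr; rewrite in_itv => /andP[/= pq qr].
apply: (@fixed_irrational R q); first by rewrite (lt_trans p0) ?(lt_trans qr).
apply/eqP; rewrite eq_le (@bern_le_above _ p) ?pfix ?(ltW pq) ?(lt_trans qr) //.
rewrite andbT leNgt; apply/negP => qA.
by have := bern_lt_above (lt_trans p0 pq) (ltW qr) r1 qA; rewrite rfix ltxx.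
Qed.

(** * Convergence of the orbits of A on either side of the fixed point *)

Section Iteration.

Local Open Scope classical_set_scope.

Variable R : realType.
Implicit Types p t : R.

Let A p := bern p alpha.

Lemma bern_continuous : continuous A.
Proof.
have -> : A = horner (characteristic_poly R alpha).
  by apply/funext => p; rewrite characteristic_polyE.
exact: continuous_horner.
Qed.

Lemma iter_bern_lim_fixed p (l : R) : iter i A p @[i --> \oo] --> l -> A l = l.
Proof.
move=> ul; apply: (@cvg_unique _ (@Rhausdorff R) (iter i.+1 A p @[i --> \oo])).
  by apply: continuous_cvg ul; exact: bern_continuous.
by move: ul; rewrite -(cvg_shiftS (fun i => iter i A p)).
Qed.

(** The orbit is nondecreasing and bounded by 1; its limit is a fixed point above t, and uniqueness
    inside (0,1) leaves only 1. *)
Lemma iter_bern_cvg1 t p : 0 < t < 1 -> A t = t -> t < p <= 1 ->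
  iter i A p @[i --> \oo] --> (1 : R).
Proof.
move=> t01 tfix /andP[tp p1]; have /andP[t0 t1] := t01.
have A_ge r : t <= r <= 1 -> r <= A r.
  move=> /andP[tr]; rewrite le_eqVlt => /predU1P[->|r1].
    by rewrite /A (bern1_fixed t01 tfix).
  by apply: (bern_le_above t0 tr r1); rewrite -/(A t) tfix.
pose u i := iter i A p.
have u_ge i : t <= u i <= 1.
  elim: i => [|i IHi]; first by rewrite (ltW tp).
  have /andP[ti i1] := IHi; rewrite (le_trans ti) /=; last exact: A_ge.
  by apply: bern_le1; rewrite i1 (le_trans (ltW t0)).
have u_nd : nondecreasing_seq u by apply/nondecreasing_seqP => i; exact: A_ge.
have u_cvg : cvgn u.
  apply: nondecreasing_is_cvgn => //; exists 1 => _ [i _ <-].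
  by have /andP[] := u_ge i.
have l_ge : p <= limn u by apply: (nondecreasing_cvgn_le u_nd u_cvg 0).
have l_le : limn u <= 1.
  by apply: limr_le => //; apply: nearW => i; have /andP[] := u_ge i.
have lfix := iter_bern_lim_fixed u_cvg.
move: l_le; rewrite le_eqVlt => /predU1P[<- //|l1].
have tl : t < limn u := lt_le_trans tp l_ge.
have l01 : 0 < limn u < 1 by rewrite l1 (lt_trans t0).
by have := bern_fixed_unique t01 l01 tfix lfix => te; rewrite -te ltxx in tl.
Qed.

Lemma iter_bern_cvg0 t p : 0 < t < 1 -> A t = t -> 0 <= p < t ->
  iter i A p @[i --> \oo] --> (0 : R).
Proof.
move=> t01 tfix /andP[p0 pt]; have /andP[t0 t1] := t01.
have A_le r : 0 <= r <= t -> A r <= r.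
  rewrite [0 <= r]le_eqVlt => /andP[/predU1P[<- _|r0 rt]].
    by rewrite /A (bern0_fixed t01 tfix).
  (* A point r < t with A(r) > r would propagate the strict inequality to t itself. *)
  rewrite leNgt; apply/negP => rA.
  by have := bern_lt_above r0 rt t1 rA; rewrite -/(A t) tfix ltxx.
pose u i := iter i A p.
have u_le i : 0 <= u i <= t.
  elim: i => [|i IHi]; first by rewrite p0 (ltW pt).
  have /andP[i0 it] := IHi; rewrite (le_trans (A_le _ IHi)) // andbT.
  by apply: bern_ge0; rewrite i0 (le_trans it) ?ltW.
have u_ni : nonincreasing_seq u by apply/nonincreasing_seqP => i; exact: A_le.
have u_cvg : cvgn u.
  apply: nonincreasing_is_cvgn => //; exists 0 => _ [i _ <-].
  by have /andP[] := u_le i.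
have l_le : limn u <= p by apply: (nonincreasing_cvgn_ge u_ni u_cvg 0).
have l_ge : 0 <= limn u.
  by apply: limr_ge => //; apply: nearW => i; have /andP[] := u_le i.
have lfix := iter_bern_lim_fixed u_cvg.
move: l_ge; rewrite le_eqVlt => /predU1P[-> //|l0].
have lt : limn u < t := le_lt_trans l_le pt.
have l01 : 0 < limn u < 1 by rewrite l0 (lt_trans lt).
by have := bern_fixed_unique t01 l01 tfix lfix => te; rewrite -te ltxx in lt.
Qed.

End Iteration.

End FixedPoint.

(** * Reduction of the growth process to iteration of A at each input *)

Section Growth.

Variables (R : realType) (k n : nat) (alpha : boolfun k).
Implicit Types (pi mu : boolfun n -> R) (x : cube n).

Definition prob_true pi x : R := \sum_(f : boolfun n | f x) pi f.

Lemma growth_step_sum pi (P : pred (boolfun n)) :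
  \sum_(f | P f) growth_step alpha pi f =
  \sum_(g : {ffun 'I_k -> boolfun n} | P (bcomp alpha g)) \prod_j pi (g j).
Proof.
rewrite [RHS](partition_big (fun g => bcomp alpha g) P) //=.
apply: eq_bigr => f Pf; apply: eq_bigl => g.
by case: eqP => [->|_]; rewrite ?Pf ?andbF.
Qed.

Lemma growth_step_distr pi : is_distr pi -> is_distr (growth_step alpha pi).
Proof.
move=> [pi_ge0 pi_sum]; split=> [f|].
  by apply: sumr_ge0 => g _; apply: prodr_ge0.
rewrite growth_step_sum -(bigA_distr_bigA (fun _ : 'I_k => pi)) /=.
by rewrite pi_sum prodr_const expr1n.
Qed.

(** The values at x of independent random functions are independent bits, each true with probability
    [prob_true pi x]. *)
Lemma prob_true_step pi x : is_distr pi ->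
  prob_true (growth_step alpha pi) x = bern (prob_true pi x) alpha.
Proof.
move=> [_ pi_sum]; rewrite /prob_true growth_step_sum.
rewrite (partition_big (fun g : {ffun 'I_k -> boolfun n} =>
  [ffun j => g j x] : cube k) alpha) /=; last by move=> g; rewrite ffunE.
apply: eq_bigr => y ay.
(* The tuples whose values at x form the vector y are a product set, so their total mass factors
   over j. *)
pose Q (j : 'I_k) (h : boolfun n) := h x == y j.
transitivity (\sum_(g in family Q) \prod_j pi (g j)).
  apply: eq_bigl => g; rewrite ffunE; apply/andP/familyP => [[_ /eqP gy] j|gy].
    by rewrite unfold_in /= /Q -gy ffunE.
  suff gE : [ffun j => g j x] = y by rewrite gE ay.
  by apply/ffunP => j; rewrite ffunE; apply/eqP/gy.
rewrite -(bigA_distr_big_dep _ (fun _ => pi)); apply: eq_bigr => j _.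
rewrite /Q; case: (y j); first by apply: eq_bigl => h; rewrite eqb_id.
rewrite -pi_sum [in RHS](bigID (fun h : boolfun n => h x)) /= addrAC subrr add0r.
by apply: eq_bigl => h; rewrite eqbF_neg.
Qed.

Lemma growth_distr_is_distr mu i : is_distr mu -> is_distr (growth_distr mu alpha i).
Proof. by move=> mud; elim: i => //= i; apply: growth_step_distr. Qed.

Lemma prob_true_growth mu x i : is_distr mu ->
  prob_true (growth_distr mu alpha i) x =
  iter i (fun p => bern p alpha) (prob_true mu x).
Proof.
by move=> mud; elim: i => //= i <-; rewrite prob_true_step //; apply: growth_distr_is_distr.
Qed.

Lemma proj_fun_inj : injective (@proj_fun n).
Proof.
move=> i j /ffunP /(_ [ffun l => l == i]); rewrite !ffunE eqxx.
by move/esym/eqP => ->.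
Qed.

(** Each of the n distinct projections has mass 1/n, and those true at x correspond to the ones in
    x. *)
Lemma prob_true_projections mu x : is_distr mu -> uniform_on_support mu ->
  distr_support mu = projections n -> prob_true mu x = (weight x)%:R / n%:R.
Proof.
move=> [_ mu_sum] mu_unif mu_supp.
have mu0 f : f \notin projections n -> mu f = 0.
  by rewrite -mu_supp inE negbK => /eqP.
have sum_proj (P : pred (boolfun n)) :
    \sum_(f | P f) mu f = \sum_(i | P (proj_fun i)) mu (proj_fun i).
  rewrite (bigID (mem (projections n))) /= [X in _ + X]big1 ?addr0; last first.
    by move=> f /andP[_ /mu0].
  under eq_bigl do rewrite andbC.
  by rewrite big_imset_cond //= => i j _ _; exact: proj_fun_inj.
have mu_proj i : mu (proj_fun i) = n%:R^-1.
  have : \sum_j mu (proj_fun j) = 1 by rewrite -mu_sum sum_proj.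
  rewrite (eq_bigr (fun=> mu (proj_fun i))) => [|j _]; last first.
    by apply: mu_unif; rewrite mu_supp imset_f.
  rewrite sumr_const card_ord -[LHS]mulr_natl => mu1.
  have n_neq0 : n%:R != 0 :> R by apply: contra_eq_neq mu1 => ->; rewrite mul0r eq_sym oner_eq0.
  by apply: (mulfI n_neq0); rewrite mu1 divff.
rewrite /prob_true sum_proj (eq_bigr (fun=> n%:R^-1)) => [|i _]; last exact: mu_proj.
rewrite sumr_const -[LHS]mulr_natl; congr (_%:R * _).
by rewrite /weight cardsE; apply: eq_card => i; rewrite unfold_in /= ffunE.
Qed.

End Growth.

(** * From convergence at each input to convergence of the distributions *)

Section Concentration.

Local Open Scope classical_set_scope.

Variables (R : realType) (n : nat) (pi : nat -> boolfun n -> R) (T : boolfun n).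
Hypothesis pi_distr : forall i, is_distr (pi i).
Hypothesis pi_true : forall x, prob_true (pi i) x @[i --> \oo] --> ((T x)%:R : R).

(** The sum over all inputs of the probability of disagreeing with [T] there. *)
Let err i : R := \sum_(x : cube n)
  (if T x then 1 - prob_true (pi i) x else prob_true (pi i) x).

Let err_cvg : err i @[i --> \oo] --> (0 : R).
Proof.
have -> : (0 : R) = \sum_(x : cube n) 0 by rewrite big1.
apply: cvg_big => [|x _]; first exact: add_continuous.
have := @pi_true x; case: (T x) => //= px; rewrite -[X in _ --> X](subrr 1).
by apply: cvgB => //; exact: cvg_cst.
Qed.

(** Union bound: a function other than [T] disagrees with it at some input. *)
Let err_ge i : 1 - pi i T <= err i.
Proof.
have [pi_ge0 pi_sum] := pi_distr i.
have -> : 1 - pi i T = \sum_(f | f != T) pi i f.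
  by rewrite -pi_sum (bigD1 T) //= addrAC subrr add0r.
have errE : err i = \sum_(x : cube n) \sum_(f : boolfun n | f x != T x) pi i f.
  apply: eq_bigr => x _; rewrite -pi_sum /prob_true.
  case: (T x); last by apply: eq_bigl => f; case: (f x).
  rewrite (bigID (fun f : boolfun n => f x)) /= addrAC subrr add0r.
  by apply: eq_bigl => f; case: (f x).
rewrite errE (exchange_big_dep (fun f => f != T)) /=; last first.
  by move=> x f _; apply: contraNneq => ->.
apply: ler_sum => f fT; have [x fx] : exists x, f x != T x.
  apply/existsP; apply: contraR fT; rewrite negb_exists => /forallP fT.
  by apply/eqP/ffunP => x; apply/eqP; rewrite -[_ == _]negbK.
by rewrite (bigD1 x) //= lerDl sumr_ge0.
Qed.

(** The mass of [T] is squeezed between 1 - [err i] and 1, any other mass between 0 and [err i]. *)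
Lemma concentrated_cvg f : pi i f @[i --> \oo] --> ((f == T)%:R : R).
Proof.
have pi_ge0 i g : 0 <= pi i g by have [] := pi_distr i.
have pi_split i : pi i T + \sum_(g | g != T) pi i g = 1.
  by have [_ <-] := pi_distr i; rewrite [RHS](bigD1 T).
have [->|fT] := eqVneq f T.
  apply: (@squeeze_cvgr _ _ _ _ (fun i => 1 - err i) (fun=> 1)).
  - apply: nearW => i; rewrite lerBlDl -lerBlDr err_ge /=.
    by rewrite -(pi_split i) lerDl sumr_ge0.
  - by rewrite -[X in _ --> X](subr0 1); apply: cvgB => //; exact: cvg_cst.
  - exact: cvg_cst.
apply: (@squeeze_cvgr _ _ _ _ (fun=> 0) err) => //; last exact: cvg_cst.
apply: nearW => i; rewrite pi_ge0 /= (le_trans _ (err_ge i)) //.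
rewrite -(pi_split i) addrAC subrr add0r (bigD1 f) //= lerDl.
by rewrite sumr_ge0.
Qed.

End Concentration.

Theorem theorem5p4 (R : realType) (k n : nat) (alpha : boolfun k)
    (mu : boolfun n -> R) (t : R)
    (alpha_monotone : monotone_connective alpha)
    (alpha_unbalanced : ~~ balanced_connective alpha)
    (t_gt0 : 0 < t) (t_lt1 : t < 1)
    (t_fixed : (characteristic_poly R alpha).[t] = t)
    (mu_distr : is_distr mu)
    (mu_uniform : uniform_on_support mu)
    (mu_support : distr_support mu = projections n) :
  has_limit_distr mu alpha /\
  concentrated_on (limit_distr mu alpha)
    (threshold_fun n `|Num.ceil (t * n%:R)|%N).
Proof.
set m := `|_|%N; pose T := threshold_fun n m.
have t01 : 0 < t < 1 by rewrite t_gt0.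
have tfix : bern t alpha = t by rewrite -[RHS]t_fixed characteristic_polyE.
(* For n = 0 there are no projections, so [mu] would vanish and could not have total mass 1. *)
have n_gt0 : 0 < n%:R :> R.
  rewrite ltr0n lt0n; apply: contra_eq_neq mu_distr.2 => n0.
  rewrite big1 ?(eq_sym 0) ?oner_eq0 // => f _; apply/eqP/negPn.
  have : f \notin projections n.
    by apply/imsetP => -[[i ilt] _ _]; move: ilt; rewrite n0.
  by rewrite -mu_support inE.
(* An integer w satisfies w >= tn iff it is at least the ceiling of tn; this ceiling is nonnegative,
   so the absolute value in [m] leaves it unchanged. *)
have TE (x : cube n) : T x = (t <= (weight x)%:R / n%:R).
  rewrite ffunE ler_pdivlMr // -[(weight x)%:R]/((weight x)%:Z%:~R) -ceil_le_int.
  by rewrite -lez_nat /m gez0_abs // ceil_ge0 (lt_trans _ (mulr_gt0 t_gt0 n_gt0)) ?ltrN10.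
have pi_distr i : is_distr (growth_distr mu alpha i) by exact: growth_distr_is_distr.
have cvgT f : (growth_distr mu alpha i f @[i --> \oo] --> ((f == T)%:R : R))%classic.
  apply: concentrated_cvg => // x.
  under eq_fun do rewrite prob_true_growth // prob_true_projections //.
  set p := _ / _.
  have p01 : 0 <= p <= 1.
    rewrite divr_ge0 //= ler_pdivrMr // mul1r ler_nat.
    by rewrite -[leqRHS](card_ord n) max_card.
  have [p0 p1] := andP p01.
  have pE : p = ratr ((weight x)%:R / n%:R) by rewrite rmorphM fmorphV !rmorph_nat.
  rewrite TE -/p; have [tp|pt|tp] := ltgtP t p => /=.
  - by apply: (iter_bern_cvg1 alpha_monotone alpha_unbalanced t01 tfix); rewrite tp.
  - by apply: (iter_bern_cvg0 alpha_monotone alpha_unbalanced t01 tfix); rewrite p0.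
  (* The boundary case t = w/n would make the fixed point t rational. *)
  - case: (@fixed_irrational _ _ alpha_monotone alpha_unbalanced R
      ((weight x)%:R / n%:R)); by rewrite -pE -tp.
split=> [f|]; first by apply/cvg_ex; exists (f == T)%:R; exact: cvgT.
by rewrite /concentrated_on /limit_distr (cvg_lim _ (cvgT T)) ?eqxx.
Qed.
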